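(* There exist point sets $U_n\subset\mathbb{R}^2$ of size $32n\log_2 n+\Theta(n)$ such that every $st$-outerplanar graph with $n$ vertices has a dominance drawing whose vertices are placed at distinct points of $U_n$.
   Context: A dominance drawing of a directed acyclic graph places its vertices at distinct points of the plane so that there is a directed path from $u$ to $v$ if and only if both coordinates of $v$ are greater than or equal to the corresponding coordinates of $u$. An $st$-outerplanar graph is an outerplanar directed acyclic graph with a single source $s$ (vertex with no incoming edges) and a single sink $t$ (vertex with no outgoing edges). *)

(* Defs.v *)
From mathcomp Require Import all_boot.
From Stdlib Require Import Reals List.

Set Implicit Arguments.
Unset Strict Implicit.
Unset Printing Implicit Defensive.

(* Directed acyclic: no directed cycle (this also excludes self-loops). *)
Definition acyclic (n : nat) (E : rel 'I_n) : Prop :=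
  forall u v : 'I_n, E u v -> ~~ connect E v u.

Definition is_source (n : nat) (E : rel 'I_n) (v : 'I_n) : Prop :=
  forall u : 'I_n, ~~ E u v.
Definition is_sink (n : nat) (E : rel 'I_n) (v : 'I_n) : Prop :=
  forall u : 'I_n, ~~ E v u.

(* Two chords of a circle with endpoints at (cyclic) positions {a,b} and
   {c,d} cross iff their endpoints strictly interleave. *)
Definition chords_cross (a b c d : nat) : Prop :=
  let x1 := minn a b in let y1 := maxn a b in
  let x2 := minn c d in let y2 := maxn c d in
  ((x1 < x2) && (x2 < y1) && (y1 < y2)) \/
  ((x2 < x1) && (x1 < y2) && (y2 < y1)).

(* Outerplanar (underlying undirected graph): the vertices can be placed in
   convex position on a circle, in the cyclic order given by the bijection
   pos, so that no two edges (straight chords) cross. *)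
Definition outerplanar (n : nat) (E : rel 'I_n) : Prop :=
  exists pos : 'I_n -> 'I_n, injective pos /\
    forall a b c d : 'I_n, E a b -> E c d ->
      ~ chords_cross (pos a) (pos b) (pos c) (pos d).

Definition st_outerplanar (n : nat) (E : rel 'I_n) : Prop :=
  outerplanar E /\ acyclic E /\
  (exists s : 'I_n, forall v, is_source E v <-> v = s) /\
  (exists t : 'I_n, forall v, is_sink E v <-> v = t).

Definition dominance_drawing (n : nat) (E : rel 'I_n) (p : 'I_n -> (R * R)%type) : Prop :=
  injective p /\
  forall u v : 'I_n,
    connect E u v <-> (Rle (fst (p u)) (fst (p v)) /\ Rle (snd (p u)) (snd (p v))).

Definition log2 (x : R) : R := Rdiv (ln x) (ln 2).

(* Main.v *)
(* The circle minus s and t consists of two arcs, and by planarity the vertices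
   of each arc form a chain for reachability.  The edges between the two chains
   do not cross, so they are linearly ordered, and reachability between the
   chains is generated by them.

   A vertex v is given an interval [a, b] of a time line and drawn at (a, b) or
   at (b, a), according to its chain.  If the intervals increase along each
   chain, this is a dominance drawing as soon as vertices of different chains
   are comparable exactly when their intervals are disjoint.  Cut the ordered
   sequence of edges between the chains into maximal runs of equally directed
   edges.  Such intervals exist in which every run c is assigned a time t_c, at
   which the vertices of one chain ("enders") end and those of the other
   ("starters") start in an interleaved way, while the remaining vertices
   ("switches") have intervals [t_c, t_(c+1)].

   The time line is fixed in advance by divide and conquer.  The run containing
   the median vertex is placed in the middle of the line together with the
   switch and the riffle after it, which leaves at most half of the vertices on
   each side.  With 16 * 2^k points for a box of capacity 2^k - 1, this gives
   16 k 2^k points in total, where 2^(k - 1) <= n < 2^k, i.e. at most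
   32 n log_2 n + 32 n; the exact order of growth is reached by adding points. *)

Require Import Defs.
From mathcomp Require Import all_boot zify.

Set Implicit Arguments.
Unset Strict Implicit.
Unset Printing Implicit Defensive.

(** * The universal family of intervals *)

(** Layout from left to right: left sub-box, window of the median run, window of the next run, right
    sub-box. *)
Fixpoint box_width k := if k is k'.+1 then 2 * box_width k' + 2 * (2 * 2 ^ k + 2) else 0.

(* On a window of width [2 * s + 2] at [q]: enders start at [q] and end in one
   of the [s] slots [q + 1 + i], starters run from such a slot to the last
   position.  The [s] positions in between are left to switches ending here. *)
Definition riffle_gadget s q : seq (nat * nat) :=
  [seq (q, q + 1 + i) | i <- iota 0 s] ++ [seq (q + 1 + i, q + 1 + 2 * s) | i <- iota 0 s].

Definition switch_gadget s a b : seq (nat * nat) := [seq (a, b + i) | i <- iota 0 s].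

(* The switches that meet the left (right) boundary of a box have to reach the
   window next to it, which belongs to an enclosing box: [a0] is the start
   ([b0] the first end) prescribed for them. *)
Fixpoint intervals k o a0 b0 : seq (nat * nat) :=
  if k is k'.+1 then
    let s := 2 ^ k in
    let q1 := o + box_width k' in
    let q2 := q1 + (2 * s + 2) in
    intervals k' o a0 (q1 + 1 + s) ++ intervals k' (q2 + (2 * s + 2)) q2 b0
    ++ riffle_gadget s q1 ++ riffle_gadget s q2
    ++ switch_gadget s a0 b0 ++ switch_gadget s a0 (q2 + 1 + s)
    ++ switch_gadget s q1 b0 ++ switch_gadget s q1 (q2 + 1 + s)
  else [::].

(** With [s = 2 ^ k], the top level adds two riffles of [2 * s] and four switch gadgets of [s]
    intervals. Every lower level adds the same total, since boxes double in number while [s]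
    halves. *)
Lemma size_intervals k o a0 b0 : size (intervals k o a0 b0) = 8 * k * 2 ^ k.
Proof.
elim: k o a0 b0 => [|k IH] o a0 b0 //=.
rewrite !size_cat !IH !size_map !size_iota expnS; lia.
Qed.

(** * Labelled words *)

(* A label is a pair of a key and a boolean.  Key [2 * c] is the riffle of run
   [c] ([true] for its starters, [false] for its enders) and key [2 * c + 1]
   the switch after run [c].  A switch behaves as a block of last enders of the
   run before it and of first starters of the run after it, whence the halves
   in [incomp]. *)
Definition is_starter key (T : bool) := odd key || T.
Definition is_ender key (T : bool) := odd key || ~~ T.
Definition incomp key1 T1 key2 T2 :=
  [&& is_starter key1 T1, is_ender key2 T2 & uphalf key1 == key2./2].
(** Directions alternate between runs: enders of run [c] and the switch after it lie on side
    [odd c], starters of run [c] on the other side. *)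
Definition label_side key (T : bool) := odd key./2 (+) (~~ odd key && T).

Lemma riffle_side c T1 T2 :
  (label_side c.*2 T1 == label_side c.*2 T2) = (T1 == T2).
Proof. by rewrite /label_side odd_double doubleK; case: (odd c) T1 T2 => [] [] []. Qed.

Lemma riffle_incomp c T1 T2 : incomp c.*2 T1 c.*2 T2 = T1 && ~~ T2.
Proof.
by rewrite /incomp /is_starter /is_ender odd_double doubleK uphalf_double eqxx andbT.
Qed.

Lemma monotone_cut (key : nat -> nat) i1 i2 K :
  i1 <= i2 -> {in [pred i | i1 <= i < i2] &, {homo key : i j / i <= j}} ->
  exists2 j, i1 <= j <= i2 & forall i, i1 <= i < i2 -> (i < j) = (key i < K).
Proof.
elim: i2 => [|i2 IH] le12 mono; first by exists 0; [lia|lia].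
case: (leqP i1 i2) => le1; last by exists i1; lia.
case: IH => // [i j Hi Hj|j lej Hj]; first by apply: mono; move: Hi Hj; rewrite !inE; lia.
case: (ltnP (key i2) K) => HK.
  exists i2.+1 => // [|i Hi]; first by lia.
  have := mono i i2; rewrite !inE; lia.
exists j => [|i Hi]; first by lia.
case: (ltnP i i2) => Hi2; first by apply: Hj; lia.
have -> : i = i2 by lia.
lia.
Qed.

(** * Placing a labelled word into a box *)

Section Placement.

Variables (N : nat) (key : nat -> nat) (T : nat -> bool).
Hypothesis key_mono : forall i j, i <= j -> j < N -> key i <= key j.

(** Meant for [i < j]. Strict overlap of the intervals expresses incomparability. *)
Definition interval_order (f g : nat -> nat) i j :=
  if label_side (key i) (T i) == label_side (key j) (T j)
  then [&& f i <= f j, g i <= g j & (f i < f j) || (g i < g j)]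
  else if incomp (key i) (T i) (key j) (T j) then (f j < g i) && (f i < g j)
  else g i <= f j.

(** The box holds the labels strictly between the riffles of runs [c1] and [c2 + 1]. Switches at its
    ends stick out, so their outer endpoints are prescribed by [a0] and [b0]. *)
Definition placed_in k o a0 b0 c1 c2 (f g : nat -> nat) i :=
  [&& (f i, g i) \in intervals k o a0 b0, f i < g i,
      if key i == c1.*2.+1 then f i == a0 else o <= f i < o + box_width k
    & if key i == c2.*2.+1 then b0 <= g i < b0 + 2 ^ k
      else o <= g i < o + box_width k].

Lemma interval_order_far f g i j :
  f i < g i -> f j < g j -> uphalf (key i) < (key j)./2 -> g i <= f j ->
  interval_order f g i j.
Proof.
move=> lti ltj ltk le; rewrite /interval_order /incomp (ltn_eqF ltk) !andbF le.
by case: ifP => // _; lia.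
Qed.

Lemma interval_order_same f g i j :
  label_side (key i) (T i) = label_side (key j) (T j) ->
  [&& f i <= f j, g i <= g j & (f i < f j) || (g i < g j)] -> interval_order f g i j.
Proof. by rewrite /interval_order => ->; rewrite eqxx. Qed.

Lemma interval_order_incomp f g i j :
  label_side (key i) (T i) != label_side (key j) (T j) ->
  incomp (key i) (T i) (key j) (T j) -> (f j < g i) && (f i < g j) ->
  interval_order f g i j.
Proof. by rewrite /interval_order => /negbTE -> ->. Qed.

(* The box is split at the run [c] of the median element: the riffles of [c] and
   [c + 1] and the switch between them go to the middle, and at most half of the
   elements remain on either side. *)
Lemma placement k o a0 b0 i1 i2 c1 c2 :
  i2 <= N -> a0 < o -> o + box_width k <= b0 -> i2 - i1 < 2 ^ k ->
  (forall i, i1 <= i < i2 -> c1.*2 < key i <= c2.*2.+1) ->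
  exists f g : nat -> nat,
    (forall i, i1 <= i < i2 -> placed_in k o a0 b0 c1 c2 f g i) /\
    (forall i j, i1 <= i -> i < j -> j < i2 -> interval_order f g i j).
Proof.
elim: k o a0 b0 i1 i2 c1 c2 => [|k IH] o a0 b0 i1 i2 c1 c2 leN lt_a0 le_b0 szi rk.
  by exists id, id; split=> *; exfalso; move: szi; lia.
case: (ltnP i1 i2) => [lt12|]; last by exists id, id; split=> *; exfalso; lia.
have p2 : 0 < 2 ^ k by rewrite expn_gt0.
have p2S : 2 ^ k.+1 = 2 * 2 ^ k by rewrite expnS.
(* Fewer than [2 ^ k] elements lie on either side of [mid]; removing the whole block around it only
   shrinks the two parts. *)
pose mid := minn (i1 + 2 ^ k - 1) (i2 - 1).
pose c := (key mid)./2.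
have cut K : exists2 j, i1 <= j <= i2 & forall i, i1 <= i < i2 -> (i < j) = (key i < K).
  by apply: monotone_cut; [lia | move=> i j _; rewrite inE => Hj ij; apply: key_mono; lia].
have [j1 j1b j1P] := cut c.*2.
have [j2 j2b j2P] := cut c.*2.+1.
have [j3 j3b j3P] := cut c.*2.+2.
have [j4 j4b j4P] := cut c.*2.+3.
have midr : i1 <= mid < i2 by rewrite /mid; lia.
have keymid : c.*2 <= key mid <= c.*2.+1 by rewrite /c; lia.
have c1c : c1 <= c by have := rk _ midr; rewrite /c; lia.
have cc2 : c <= c2 by have := rk _ midr; rewrite /c; lia.
have j1m : j1 <= mid by have := j1P _ midr; lia.
have m4 : mid < j4 by have := j4P _ midr; lia.
pose s := 2 ^ k.+1; pose h := box_width k.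
pose q1 := o + h; pose q2 := q1 + (2 * s + 2).
have hS : box_width k.+1 = 2 * h + 2 * (2 * s + 2) by [].
(* Switches after run [c - 1] end in the window at [q1], beyond all its slots. If [c = c1], the left
   part is empty, so the truncation in [c.-1] is harmless. *)
have [|||||fl [gl [plP ordl]]] := IH o a0 (q1 + 1 + s) i1 j1 c1 c.-1.
- by lia.
- by [].
- by rewrite /q1 /h; lia.
- by rewrite /mid in j1m; lia.
- by move=> i Hi; have := rk i; have := j1P i; lia.
have [|||||fr [gr [prP ordr]]] := IH (q2 + (2 * s + 2)) q2 b0 j4 i2 c.+1 c2.
- by [].
- by lia.
- by rewrite /q2 /q1; lia.
- by move: szi; rewrite /mid in m4; lia.
- by move=> i Hi; have := rk i; have := j4P i; lia.
(* If [c = c1], the riffle of run [c] is outside this box and its switches start at [a0]; if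
   [c = c2], they end from [b0] on. *)
pose f i := if i < j1 then fl i
  else if i < j2 then (if T i then q1 + 1 + (i - j1) else q1)
  else if i < j3 then (if c == c1 then a0 else q1)
  else if i < j4 then (if T i then q2 + 1 + (i - j3) else q2) else fr i.
pose g i := if i < j1 then gl i
  else if i < j2 then (if T i then q1 + 1 + 2 * s else q1 + 1 + (i - j1))
  else if i < j3 then (if c == c2 then b0 else q2 + 1 + s) + (i - j2)
  else if i < j4 then (if T i then q2 + 1 + 2 * s else q2 + 1 + (i - j3)) else gr i.
have zone i : i1 <= i < i2 ->
  [\/ [/\ i < j1, c1 < c & key i < c.*2], [/\ j1 <= i < j2, c1 < c & key i = c.*2],
      j2 <= i < j3 /\ key i = c.*2.+1
    | [/\ j3 <= i < j4, c < c2 & key i = c.*2.+2] \/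
      [/\ j4 <= i, c < c2 & c.*2.+2 < key i]].
  move=> Hi; have := j1P i Hi; have := j2P i Hi; have := j3P i Hi; have := j4P i Hi.
  have := rk i Hi => H H4 H3 H2 H1.
  case: (ltnP i j1) => ?; first by constructor 1; split; lia.
  case: (ltnP i j2) => ?; first by constructor 2; split; lia.
  case: (ltnP i j3) => ?; first by constructor 3; split; lia.
  case: (ltnP i j4) => ?; first by constructor 4; left; split; lia.
  by constructor 4; right; split; lia.
have fE1 i : i < j1 -> f i = fl i /\ g i = gl i.
  by rewrite /f /g => ->.
have fE2 i : j1 <= i < j2 ->
   f i = (if T i then q1 + 1 + (i - j1) else q1) /\
   g i = (if T i then q1 + 1 + 2 * s else q1 + 1 + (i - j1)).
  move=> Hi; have [A1 A2] : (i < j1) = false /\ i < j2 by split; lia.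
  by rewrite /f /g A1 A2.
have j12 : j1 <= j2.
  by case: (leqP j1 j2) => // ?; have := j1P j2; have := j2P j2; lia.
have j23 : j2 <= j3.
  by case: (leqP j2 j3) => // ?; have := j2P j3; have := j3P j3; lia.
have j34 : j3 <= j4.
  by case: (leqP j3 j4) => // ?; have := j3P j4; have := j4P j4; lia.
have fE3 i : j2 <= i < j3 -> f i = (if c == c1 then a0 else q1) /\
   g i = (if c == c2 then b0 else q2 + 1 + s) + (i - j2).
  move=> Hi; have [A1 A2 A3] : [/\ (i < j1) = false, (i < j2) = false & i < j3] by split; lia.
  by rewrite /f /g A1 A2 A3.
have fE4 i : j3 <= i < j4 ->
   f i = (if T i then q2 + 1 + (i - j3) else q2) /\
   g i = (if T i then q2 + 1 + 2 * s else q2 + 1 + (i - j3)).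
  move=> Hi; have [A1 A2 A3 A4] : [/\ (i < j1) = false, (i < j2) = false, (i < j3) = false & i < j4].
    by split; lia.
  by rewrite /f /g A1 A2 A3 A4.
have fE5 i : j4 <= i -> f i = fr i /\ g i = gr i.
  move=> Hi; have [A1 A2 A3 A4] : [/\ (i < j1) = false, (i < j2) = false, (i < j3) = false & (i < j4) = false].
    by split; lia.
  by rewrite /f /g A1 A2 A3 A4.
have slot a b i n : i < n -> (a, b + i) \in switch_gadget n a b.
  by move=> lti; apply/mapP; exists i; rewrite ?mem_iota.
have slotE q i n : i < n -> (q, q + 1 + i) \in riffle_gadget n q.
  by move=> lti; rewrite /riffle_gadget mem_cat; apply/orP; left; apply/mapP; exists i; rewrite ?mem_iota.
have slotT q i n : i < n -> (q + 1 + i, q + 1 + 2 * n) \in riffle_gadget n q.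
  by move=> lti; rewrite /riffle_gadget mem_cat; apply/orP; right; apply/mapP; exists i; rewrite ?mem_iota.
have szs i : i1 <= i < i2 -> i - i1 < s by rewrite /s; lia.
have s2 : s = 2 * 2 ^ k by [].
have q1E : q1 = o + h by [].
have q2E : q2 = q1 + (2 * s + 2) by [].
have mem_node x y : (x, y) \in intervals k.+1 o a0 b0 =
  [|| (x, y) \in intervals k o a0 (q1 + 1 + s), (x, y) \in intervals k (q2 + (2 * s + 2)) q2 b0,
      (x, y) \in riffle_gadget s q1, (x, y) \in riffle_gadget s q2,
      (x, y) \in switch_gadget s a0 b0, (x, y) \in switch_gadget s a0 (q2 + 1 + s),
      (x, y) \in switch_gadget s q1 b0 | (x, y) \in switch_gadget s q1 (q2 + 1 + s)].
  by rewrite /intervals -/intervals !mem_cat.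
have plQ i : i1 <= i < j1 -> [/\ (fl i, gl i) \in intervals k o a0 (q1 + 1 + s), fl i < gl i,
    if key i == c1.*2.+1 then fl i == a0 else o <= fl i < q1
    & if key i == c.-1.*2.+1 then q1 + 1 + s <= gl i < q1 + 1 + 2 * s else o <= gl i < q1].
  move=> Hi; have /and4P[A B C D] := plP i Hi; split=> //.
  by case: ifP D => // _ D; rewrite s2; lia.
have prQ i : j4 <= i < i2 -> [/\ (fr i, gr i) \in intervals k (q2 + (2 * s + 2)) q2 b0, fr i < gr i,
    if key i == c.+1.*2.+1 then fr i == q2 else q2 + (2 * s + 2) <= fr i < o + box_width k.+1
    & if key i == c2.*2.+1 then b0 <= gr i < b0 + s else q2 + (2 * s + 2) <= gr i < o + box_width k.+1].
  move=> Hi; have /and4P[A B C D] := prP i Hi; split=> //.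
    by case: ifP C => // _ C; rewrite hS; lia.
  by case: ifP D => // _ D; rewrite ?hS; lia.
have wS : q2 + (2 * s + 2) + h = o + box_width k.+1 by rewrite hS; lia.
have sE : 2 ^ k.+1 = s by [].
exists f, g; split.
  move=> i Hi; have si := szs i Hi; rewrite /placed_in mem_node sE.
  case: (zone i Hi) => [[A B C]|[A B C]|[A C]|[[A B C]|[A B C]]].
  - have [-> ->] := fE1 i A; have [|-> -> D E] := plQ i; first (by lia); rewrite ?orTb ?andTb.
    by move: D E; case: ifP; case: ifP; case: ifP; lia.
  - have [-> ->] := fE2 i A; case: (T i).
      by rewrite slotT ?orbT ?andTb; try (case: ifP; case: ifP); lia.
    by rewrite slotE ?orbT ?andTb; try (case: ifP; case: ifP); lia.
  - have [-> ->] := fE3 i A; case: (c =P c1) => ?; case: (c =P c2) => ?;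
    by rewrite slot ?orbT ?andTb; try (case: ifP; case: ifP); lia.
  - have [-> ->] := fE4 i A; case: (T i).
      by rewrite slotT ?orbT ?andTb; try (case: ifP; case: ifP); lia.
    by rewrite slotE ?orbT ?andTb; try (case: ifP; case: ifP); lia.
  - have [-> ->] := fE5 i A; have [|-> -> D E] := prQ i; first (by lia); rewrite ?orbT ?andTb.
    by move: D E; case: ifP; case: ifP; case: ifP; lia.
move=> i j Hi ij Hj.
have Hi' : i1 <= i < i2 by lia.
have Hj' : i1 <= j < i2 by lia.
have si := szs i Hi'; have sj := szs j Hj'.
clear plP prP IH cut j1P j2P j3P j4P rk szs mem_node slot slotE slotT.
case: (zone i Hi') => [[A B C]|[A B C]|[A C]|[[A B C]|[A B C]]];
  case: (zone j Hj') => [[A' B' C']|[A' B' C']|[A' C']|[[A' B' C']|[A' B' C']]];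
  try (by exfalso; lia); clear zone; clearbody s h q1 q2 mid c.
- have [E1 E2] := fE1 i A; have [E3 E4] := fE1 j A'.
  by have := ordl i j Hi ij A'; rewrite /interval_order E1 E2 E3 E4.
- have [E1 E2] := fE1 i A; have [E3 E4] := fE2 j A'.
  have [|_ FG F G] := plQ i; first by lia.
  have Fi : f i < q1 by move: F; case: ifP; lia.
  (* Among the intervals of the left part, only switches after run [c - 1] reach into the window of
     run [c]. *)
  case: (eqVneq (key i) c.-1.*2.+1) => ki.
    have Gi : q1 + 1 + s <= g i < q1 + 1 + 2 * s by move: G; rewrite ki eqxx E2.
    case Tj: (T j) E3 E4 => E3 E4.
      by apply: interval_order_same; rewrite ?ki ?C' ?Tj /label_side; lia.
    by apply: interval_order_incomp; rewrite ?ki ?C' ?Tj /label_side /incomp /is_starter /is_ender; lia.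
  have Gi : g i < q1 by move: G; rewrite (negbTE ki) E2; lia.
  by apply: interval_order_far; [lia | move: E3 E4; case: ifP; lia | lia | move: E3; case: ifP; lia].
- have [E1 E2] := fE1 i A; have [E3 E4] := fE3 j A'.
  have [|_ FG F G] := plQ i; first by lia.
  have Fi : f i < q1 by move: F; case: ifP; lia.
  have Fj : f j = q1 by rewrite E3 ifF //; lia.
  have Gj : q2 < g j by move: E4; case: ifP; lia.
  case: (eqVneq (key i) c.-1.*2.+1) => ki.
    have Gi : q1 + 1 + s <= g i < q1 + 1 + 2 * s by move: G; rewrite ki eqxx E2.
    by apply: interval_order_incomp; rewrite ?ki ?C' /label_side /incomp /is_starter /is_ender; lia.
  have Gi : g i < q1 by move: G; rewrite (negbTE ki) E2; lia.
  by apply: interval_order_far; lia.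
- have [E1 E2] := fE1 i A; have [E3 E4] := fE4 j A'.
  have [|_ FG F G] := plQ i; first by lia.
  have Fj : q2 <= f j by move: E3; case: ifP; lia.
  have Gi : g i < q2 by move: G; rewrite E2; case: ifP; lia.
  by apply: interval_order_far; [lia | move: E3 E4; case: ifP; lia | lia | lia].
- have [E1 E2] := fE1 i A; have [E3 E4] := fE5 j A'.
  have [|_ FG F G] := plQ i; first by lia.
  have [|_ FG' F' G'] := prQ j; first by lia.
  have Fj : q2 <= f j by move: F'; rewrite E3; case: ifP; lia.
  have Gi : g i < q2 by move: G; rewrite E2; case: ifP; lia.
  by apply: interval_order_far; lia.
- have [E1 E2] := fE2 i A; have [E3 E4] := fE2 j A'.
  by rewrite /interval_order C C' riffle_side riffle_incomp E1 E2 E3 E4;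
     case: (T i); case: (T j) => /=; lia.
- have [E1 E2] := fE2 i A; have [E3 E4] := fE3 j A'.
  have Fj : f j = q1 by rewrite E3 ifF //; lia.
  have Gj : q2 < g j by move: E4; case: ifP; lia.
  case Ti: (T i) E1 E2 => E1 E2.
    by apply: interval_order_incomp; rewrite ?C ?C' ?Ti /label_side /incomp /is_starter /is_ender; lia.
  by apply: interval_order_same; rewrite ?C ?C' ?Ti /label_side; lia.
- have [E1 E2] := fE2 i A; have [E3 E4] := fE4 j A'.
  by apply: interval_order_far; rewrite ?C ?C'; [ | | lia | ]; rewrite ?E1 ?E2 ?E3 ?E4;
     case: (T i); case: (T j); lia.
- have [E1 E2] := fE2 i A; have [E3 E4] := fE5 j A'.
  have [|_ FG' F' G'] := prQ j; first by lia.
  have Fj : q2 <= f j by move: F'; rewrite E3; case: ifP; lia.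
  by apply: interval_order_far; [move: E1 E2; case: ifP; lia | lia | lia | move: E2; case: ifP; lia].
- have [E1 E2] := fE3 i A; have [E3 E4] := fE3 j A'.
  apply: interval_order_same; first by rewrite C C' /label_side; lia.
  by rewrite E1 E2 E3 E4; lia.
- have [E1 E2] := fE3 i A; have [E3 E4] := fE4 j A'.
  have Fi : f i <= q1 by move: E1; case: ifP; lia.
  have Gi : g i = q2 + 1 + s + (i - j2) by rewrite E2 ifF //; lia.
  case Tj: (T j) E3 E4 => E3 E4.
    by apply: interval_order_same; rewrite ?C ?C' ?Tj /label_side; lia.
  by apply: interval_order_incomp; rewrite ?C ?C' ?Tj /label_side /incomp /is_starter /is_ender; lia.
- have [E1 E2] := fE3 i A; have [E3 E4] := fE5 j A'.
  have [|_ FG' F' G'] := prQ j; first by lia.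
  have Fi : f i <= q1 by move: E1; case: ifP; lia.
  have Gi : g i = q2 + 1 + s + (i - j2) by rewrite E2 ifF //; lia.
  case: (eqVneq (key j) c.+1.*2.+1) => kj.
    have Fj : f j = q2 by move: F'; rewrite kj eqxx E3 => /eqP.
    by apply: interval_order_incomp; rewrite ?C ?kj /label_side /incomp /is_starter /is_ender; lia.
  have Fj : q2 + (2 * s + 2) <= f j by move: F'; rewrite (negbTE kj) E3; lia.
  by apply: interval_order_far; lia.
- have [E1 E2] := fE4 i A; have [E3 E4] := fE4 j A'.
  by rewrite /interval_order C C' -doubleS riffle_side riffle_incomp E1 E2 E3 E4;
     case: (T i); case: (T j) => /=; lia.
- have [E1 E2] := fE4 i A; have [E3 E4] := fE5 j A'.
  have [|_ FG' F' G'] := prQ j; first by lia.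
  case: (eqVneq (key j) c.+1.*2.+1) => kj.
    have Fj : f j = q2 by move: F'; rewrite kj eqxx E3 => /eqP.
    have Gj : q2 + (2 * s + 2) <= g j by move: G'; rewrite E4; case: ifP; lia.
    case Ti: (T i) E1 E2 => E1 E2.
      by apply: interval_order_incomp; rewrite ?C ?kj ?Ti /label_side /incomp /is_starter /is_ender; lia.
    by apply: interval_order_same; rewrite ?C ?kj ?Ti /label_side; lia.
  have Fj : q2 + (2 * s + 2) <= f j by move: F'; rewrite (negbTE kj) E3; lia.
  by apply: interval_order_far; [move: E1 E2; case: ifP; lia | lia | lia | move: E2; case: ifP; lia].
- have [E1 E2] := fE5 i A; have [E3 E4] := fE5 j A'.
  by have := ordr i j A ij Hj; rewrite /interval_order E1 E2 E3 E4.
Qed.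

End Placement.

(** * From cross edges to labels *)

(* The [m]-th cross edge has its tail on side [ty m] and its end on side [b] at
   depth [co m b].  A vertex is emitted by the first edge whose tail it
   precedes or equals, or whose head it strictly precedes. *)
Section Word.

Variables (ty : nat -> bool) (co : nat -> bool -> nat).
Hypothesis co_mono : forall b m m', m <= m' -> co m b <= co m' b.
Hypothesis co_strict :
  forall m m', m < m' -> ty m != ty m' -> co m (ty m) < co m' (ty m).

Variables (V : finType) (sd : V -> bool) (rk : V -> nat).
Hypothesis rk_inj : forall u v, sd u = sd v -> rk u = rk v -> u = v.
Variable M : nat.
Hypothesis rk_bound : forall v b, rk v < co M b.

Definition emits v m :=
  if ty m == sd v then rk v <= co m (sd v) else rk v < co m (sd v).

Lemma emits_ex v : exists m, emits v m.
Proof. by exists M; rewrite /emits; have := rk_bound v (sd v); case: ifP; lia. Qed.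

Definition emission v := ex_minn (emits_ex v).

Lemma emits_emission v : emits v (emission v).
Proof. by rewrite /emission; case: ex_minnP. Qed.

Lemma emission_min v m : emits v m -> emission v <= m.
Proof. by rewrite /emission; case: ex_minnP => k _ H /H. Qed.

(* Numbers the maximal blocks of equally directed edges so that the parity of
   the number is the direction. *)
Fixpoint run m :=
  if m is m'.+1 then run m' + (ty m != ty m') else (~~ ty 0).+1.

Lemma odd_run m : odd (run m) = ty m.
Proof.
elim: m => [|m IH] /=; first by case: (ty 0).
by rewrite oddD IH; case: (ty m); case: (ty m.+1).
Qed.

Lemma run_gt0 m : 0 < run m.
Proof. by case: m => [|m] //=; elim: m => [|m IH] //=; lia. Qed.

Lemma leq_run m m' : m <= m' -> run m <= run m'.
Proof.
move=> /subnK <-; elim: (m' - m) => [|d IH] //; rewrite addSn /=; lia.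
Qed.

Lemma run_eq m m' q : run m = run m' -> m <= q <= m' -> ty q = ty m.
Proof.
move=> e /andP[/leq_run A /leq_run B]; rewrite -!odd_run; congr odd; lia.
Qed.

Lemma run_change m m' : m <= m' -> run m < run m' ->
  exists2 q, m < q <= m' & ty q != ty m.
Proof.
move=> le; rewrite -(subnKC le); elim: (m' - m) => [|d IH]; first by rewrite addn0 ltnn.
rewrite addnS /= => lt.
case: (ltnP (run m) (run (m + d))) => [/IH[q Hq tq]|ge]; first by exists q => //; lia.
exists (m + d).+1; first by lia.
have e : run m = run (m + d) by have := @leq_run m (m + d); lia.
by move: lt; rewrite e -(run_eq e (q := m + d)) ?leqnn ?leq_addr //; case: eqP; lia.
Qed.

Definition is_tail v := ty (emission v) == sd v.

Definition repeated m := if m is m'.+1 then ty m == ty m' else false.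

(** A vertex emitted on the tail side is an ender of the run of its edge. On the head side it is a
    starter, unless the edge opens its run: then it lies between two runs and is the switch before
    this one. *)
Definition vT v := ~~ is_tail v && repeated (emission v).
Definition vkey v :=
  if is_tail v || repeated (emission v) then (run (emission v)).*2
  else (run (emission v)).*2.-1.

(** For one edge, the head side is emitted before the tail side, because the edge does not lead to
    the head-side vertices it emits. *)
Definition time v := (emission v).*2 + is_tail v.

Lemma label_sideE v : label_side (vkey v) (vT v) = sd v.
Proof.
rewrite /vkey /vT /label_side; have := odd_run (emission v); have := run_gt0 (emission v).
rewrite /is_tail; case: eqP => [<-|/eqP ne] /=; first by lia.
by case: repeated; move: ne; case: (ty _); case: (sd v) => //; lia.
Qed.

Lemma vkey_gt0 v : 0 < vkey v.
Proof. by have := run_gt0 (emission v); rewrite /vkey; case: ifP; lia. Qed.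

Lemma vkey_le u v : time u <= time v -> vkey u <= vkey v.
Proof.
rewrite /time => le; have : emission u <= emission v by lia.
rewrite leq_eqVlt => /orP[/eqP e|lt].
  move: le; rewrite /vkey e; case: (is_tail u); case: (is_tail v) => //=;
  by case: repeated; lia.
have := run_gt0 (emission v); have /leq_run := ltnW lt.
rewrite /vkey => A B.
case Ev: (emission v) lt A B => [|m] // lt A B.
have := @leq_run (emission u) m lt; move: A B => /=.
by case: eqP; do 2![case: ifP]; lia.
Qed.

Definition prec u v :=
  exists q, [/\ ty q = sd u, rk u <= co q (sd u) & co q (sd v) <= rk v].

(** An edge leading from [v] to [u] comes no earlier than the emission of [v], hence of [u]; but
    then [u] lies strictly before its head. *)
Lemma prec_antitime u v : sd u != sd v -> time u <= time v -> ~ prec v u.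
Proof.
move=> ne le [q [tq rv ru]].
have mq : emission v <= q by apply: emission_min; rewrite /emits tq eqxx.
have uq : emission u <= q by move: le; rewrite /time; lia.
have := emits_emission u; rewrite /emits; case: eqP => [tu|tu] Eu.
  have lt : emission u < q.
    by rewrite ltn_neqAle uq andbT; apply: contraNneq ne => e; rewrite -tu e tq.
  by have := co_strict lt; rewrite tu tq => /(_ ne); lia.
by have := co_mono (sd u) uq; lia.
Qed.

(** The witnesses of [prec u v] are the edges with tail on the side of [u] that come no earlier than
    the emission of [u] and strictly before that of [v]. Whether one exists can be read off from the
    runs. *)
Lemma prec_incomp u v : sd u != sd v -> time u <= time v ->
  prec u v <-> ~~ incomp (vkey u) (vT u) (vkey v) (vT v).
Proof.
move=> ne le.
have mm : emission u <= emission v by move: le; rewrite /time; lia.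
have Eu := emits_emission u; have Ev := emits_emission v.
have Mu q : ty q = sd u -> rk u <= co q (sd u) -> emission u <= q.
  by move=> tq ru; apply: emission_min; rewrite /emits tq eqxx.
have Nv q : q < emission v -> ~~ emits v q.
  by rewrite ltnNge; apply: contra => /emission_min.
have gu := run_gt0 (emission u); have gv := run_gt0 (emission v).
case tu: (ty (emission u) == sd u).
  have tt : is_tail u by [].
  have lt : emission u < emission v.
    rewrite ltn_neqAle mm andbT; apply/eqP => e; move: le; rewrite /time tt e /is_tail -e (eqP tu).
    by rewrite (negbTE ne); lia.
  split=> _.
    by rewrite /incomp /is_starter /vkey /vT tt /= odd_double.
  exists (emission u); split; first exact/eqP.
    by move: Eu; rewrite /emits tu.
  have := Nv _ lt; rewrite /emits (eqP tu) (negbTE ne); lia.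
(* Now [u] counts as a starter of its run, and the question is whether [v] counts as an ender of the
   same run. *)
have tu' : ty (emission u) = sd v by move: tu ne; case: (ty _); case: (sd u); case: (sd v).
have nt : is_tail u = false by [].
have su : is_starter (vkey u) (vT u) && (uphalf (vkey u) == run (emission u)).
  by rewrite /is_starter /vkey /vT nt /=; case: (repeated _); lia.
have -> : incomp (vkey u) (vT u) (vkey v) (vT v) =
          is_ender (vkey v) (vT v) && ((vkey v)./2 == run (emission u)).
  by case/andP: su => su /eqP gE; rewrite /incomp su gE /= eq_sym.
have Ru : rk u < co (emission u) (sd u) by move: Eu; rewrite /emits tu.
have precI q : emission u <= q < emission v -> ty q = sd u -> prec u v.
  case/andP=> uq qv tq; exists q; split=> //.
    by have := co_mono (sd u) uq; lia.
  by have := Nv _ qv; rewrite /emits tq (negbTE ne); lia.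
case tv: (ty (emission v) == sd v).
  have tt : is_tail v by [].
  have -> : is_ender (vkey v) (vT v) && ((vkey v)./2 == run (emission u))
          = (run (emission u) == run (emission v)).
    by rewrite /is_ender /vkey /vT tt /= orbT doubleK eq_sym.
  split.
    case=> q [tq ruq rvq]; apply/negP => /eqP e.
    have uq := Mu _ tq ruq.
    case: (leqP q (emission v)) => qv.
      by have := run_eq e (q := q); rewrite uq qv tq tu' => /(_ isT) E; rewrite E eqxx in ne.
    have := co_strict qv; rewrite (eqP tv) tq eq_sym => /(_ ne).
    by move: Ev; rewrite /emits tv; clear -rvq; lia.
  move=> neq; have [|q /andP[uq qv] tq] := @run_change _ _ mm.
    by have := leq_run mm; rewrite ltn_neqAle neq.
  have {}tq : ty q = sd u by move: tq ne; rewrite tu'; case: (ty q); case: (sd u); case: (sd v).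
  apply: (precI q) => //; rewrite (ltnW uq) ltn_neqAle qv andbT.
  by apply: contraNneq ne => e; rewrite -tq e tv.
have nt' : is_tail v = false by [].
have tv' : ty (emission v) = sd u by move: tv ne; case: (ty _); case: (sd u); case: (sd v).
have lt : emission u < emission v.
  by rewrite ltn_neqAle mm andbT; apply: contraNneq ne => e; rewrite -tu' -tv' e.
case Em: (emission v) (lt) => [|m] // um; rewrite ltnS in um.
have rE : (vkey v)./2 == run (emission u) -> is_ender (vkey v) (vT v) -> run (emission u) = run m.
  rewrite /is_ender /vkey /vT nt' Em /=.
  by have := run_gt0 m; clear; case: (ty m.+1 == ty m); lia.
split.
  case=> q [tq ruq rvq]; apply/negP => /andP[en /eqP e].
  have {}rE := rE (introT eqP e) en.
  have uq := Mu _ tq ruq.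
  case: (leqP q m) => qm.
    by have := run_eq rE (q := q); rewrite uq qm tq tu' => /(_ isT) E; rewrite E eqxx in ne.
  have := @co_mono (sd v) (emission v) q; rewrite Em => /(_ qm).
  by move: Ev; rewrite /emits tv Em; clear -rvq; lia.
move=> nin.
case: (ltnP (run (emission u)) (run m)) => rr.
  have [q /andP[uq qv] tq] := @run_change _ _ um rr.
  have {}tq : ty q = sd u by move: tq ne; rewrite tu'; case: (ty q); case: (sd u); case: (sd v).
  by apply: (precI q) => //; rewrite Em (ltnW uq) ltnS.
(* All edges from the emission of [u] to [m] have their tails on the side of [v], so the edge
   emitting [v] opens a run and [v] is a switch, hence an ender of the run of [m]. *)
exfalso; have e : run (emission u) = run m by apply/eqP; rewrite eqn_leq rr leq_run.
have tm := run_eq e (q := m); rewrite um leqnn tu' in tm.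
have {}tm := tm isT.
move: nin; rewrite /is_ender /vkey /vT nt' Em /= -Em tv' tm (negbTE ne) /=.
by have := run_gt0 m; clear -e; lia.
Qed.

Lemma time_le u v : sd u = sd v -> rk u <= rk v -> time u <= time v.
Proof.
move=> es le; have em : emission u <= emission v.
  apply: emission_min; have := emits_emission v; rewrite /emits es.
  by case: ifP; lia.
rewrite /time /is_tail es; move: em; rewrite leq_eqVlt => /orP[/eqP ->|] //.
by case: eqP; case: eqP; lia.
Qed.

(** Lexicographic order by [time], then by [rk], which is less than [co M true]. *)
Definition word_rank v := time v * co M true + rk v.

Lemma word_rank_time u v : word_rank u <= word_rank v -> time u <= time v.
Proof.
rewrite /word_rank; have := rk_bound u true; have := rk_bound v true => A B C.
rewrite leqNgt; apply/negP => lt.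
have := leq_mul2r (co M true) (time v).+1 (time u); rewrite lt orbT; nia.
Qed.

Lemma word_rank_side u v : word_rank u <= word_rank v -> sd u = sd v -> rk u <= rk v.
Proof.
move=> le es; rewrite leqNgt; apply/negP => lt.
have := time_le (esym es) (ltnW lt); have := word_rank_time le => A B.
have e : time u = time v by lia.
by move: le; rewrite /word_rank e; lia.
Qed.

Lemma word_drawing k : #|V| < 2 ^ k ->
  exists f g : V -> nat,
    (forall v, (f v, g v) \in intervals k 1 0 (1 + box_width k) /\ f v < g v) /\
    forall u v, u != v ->
      if sd u == sd v then (rk u < rk v) = (f u <= f v) && (g u <= g v)
      else prec u v <-> g u <= f v.
Proof.
move=> szV.
case: (pickP (@predT V)) => [v0 _|V0]; last first.
  by exists (fun=> 0), (fun=> 0); split=> v; have := V0 v.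
pose w := sort (relpre word_rank leq) (enum V).
have wp : perm_eq w (enum V) by rewrite perm_sort.
have szw : size w = #|V| by rewrite (perm_size wp) cardE.
have uw : uniq w by rewrite (perm_uniq wp) enum_uniq.
have mw v : v \in w by rewrite (perm_mem wp) mem_enum.
have sw : sorted (relpre word_rank leq) w by apply: sort_sorted => u v; exact: leq_total.
have idx v : index v w < size w by rewrite index_mem.
have wle i j : i <= j -> j < size w -> word_rank (nth v0 w i) <= word_rank (nth v0 w j).
  move=> ij jw; apply: (sorted_leq_nth _ _ v0 sw) => //.
  - by move=> x y z; exact: leq_trans.
  - by move=> x /=.
  - by rewrite inE; lia.
pose key i := vkey (nth v0 w i); pose T i := vT (nth v0 w i).
have key_mono i j : i <= j -> j < size w -> key i <= key j.
  by move=> ij jw; apply/vkey_le/word_rank_time/wle.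
have [||||i _|f [g [placed ordered]]] :=
  @placement (size w) key T key_mono k 1 0 (1 + box_width k) 0 (size w) 0 (\max_v vkey v) => //.
- by rewrite subn0 szw.
- rewrite /key vkey_gt0 /=.
  by have := @leq_bigmax V vkey (nth v0 w i); lia.
exists (fun v => f (index v w)), (fun v => g (index v w)).
have fg v : (f (index v w), g (index v w)) \in intervals k 1 0 (1 + box_width k) /\
            f (index v w) < g (index v w).
  by have /and4P[A B _ _] := placed (index v w) (idx v).
split=> // u v.
have pair x y : index x w < index y w ->
  let fx := f (index x w) in let gx := g (index x w) in
  let fy := f (index y w) in let gy := g (index y w) in
  if sd x == sd y then [/\ rk x < rk y, fx <= fy, gx <= gy & (fx < fy) || (gx < gy)]
  else [/\ prec x y <-> gx <= fy, ~ prec y x & fx < gy].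
  move=> xy /=; have := ordered _ _ (leq0n _) xy (idx y).
  rewrite /interval_order /key /T !nth_index // !label_sideE.
  have le : word_rank x <= word_rank y by have := wle _ _ (ltnW xy) (idx y); rewrite !nth_index.
  have tl := word_rank_time le.
  have [_ fgx] := fg x; have [_ fgy] := fg y.
  case: eqP => [es|/eqP ne].
    case/and3P=> A B C; split=> //.
    rewrite ltn_neqAle (word_rank_side le es) andbT; apply/eqP => er.
    by move: xy; rewrite (rk_inj es er) ltnn.
  have pi := prec_incomp ne tl; have na := prec_antitime ne tl.
  case: ifP pi => [inc pi /andP[A B]|inc pi A]; split=> //; last by lia.
    by split=> [/pi //|]; lia.
  by split=> // _; exact/pi.
move=> ne; case: (ltngtP (index u w) (index v w)) => [uv|vu|e].
- have /= := pair _ _ uv; case: ifP => _ [A B C] //.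
  by move=> D; rewrite A B C.
- have /= := pair _ _ vu; rewrite eq_sym; case: ifP => _ [A B C].
    by move=> D; lia.
  by split=> // X; exfalso; have [_ P] := fg u; have [_ Q] := fg v; lia.
- by move: ne; rewrite -(nth_index v0 (mw u)) e nth_index ?eqxx.
Qed.

End Word.

(** * Outerplanar graphs with one source and one sink *)

Definition dag (V : finType) (E : rel V) := forall u v, E u v -> ~~ connect E v u.

Lemma dag_rev (V : finType) (E : rel V) : dag E -> dag [rel x y | E y x].
Proof. by move=> acE u v /= /acE; rewrite (connect_rev E). Qed.

(** An ancestor of [v] with the fewest ancestors has no incoming edge, as a predecessor would have
    strictly fewer. *)
Lemma source_connect (V : finType) (E : rel V) (s : V) :
  dag E -> (forall v, (forall u, ~~ E u v) -> v = s) -> forall v, connect E s v.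
Proof.
move=> acE srcE v.
pose anc u := #|[set w | connect E w u]|.
case: (@arg_minnP _ v (connect E ^~ v) anc (connect0 E v)) => u cuv umin.
suff <- : u = s by [].
apply: srcE => w; apply/negP => Ewu.
have cwv : connect E w v by apply: connect_trans cuv; exact: connect1.
have := umin w cwv; rewrite leqNgt => /negP; apply.
apply: proper_card; apply/properP; split.
  by apply/subsetP => x; rewrite !inE => cx; apply: connect_trans cx (connect1 Ewu).
by exists u; rewrite !inE ?connect0 // acE.
Qed.

Lemma sink_connect (V : finType) (E : rel V) (t : V) :
  dag E -> (forall v, (forall u, ~~ E v u) -> v = t) -> forall v, connect E v t.
Proof.
move=> acE snkE v.
by have := source_connect (dag_rev acE) snkE v; rewrite (connect_rev E).
Qed.

Lemma dag_antisym (V : finType) (E : rel V) u v :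
  dag E -> connect E u v -> connect E v u -> u = v.
Proof.
move=> acE /connectP[[|x p] /= pth ->] // cvu.
case/andP: pth => Eux pth; have /negP[] := acE _ _ Eux.
by apply: connect_trans cvu; apply/connectP; exists p.
Qed.

Definition noncrossing (V : finType) (E : rel V) (phi : V -> nat) :=
  forall a b c d, E a b -> E c d -> ~ chords_cross (phi a) (phi b) (phi c) (phi d).

(* A path from [s] to [v] and a path from [u] to [t] must meet: otherwise an
   edge of the first one separates [u] from [t] on the circle. *)
Lemma arc_connect (V : finType) (E : rel V) (phi : V -> nat) (s t u v : V) :
  injective phi -> noncrossing E phi -> phi s = 0 ->
  (forall x, connect E s x) -> (forall x, connect E x t) ->
  phi u <= phi v <= phi t -> connect E u v.
Proof.
move=> phiI ncE s0 cs ct /andP[uv vt].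
apply/negPn/negP => nuv.
have nus : u != s by apply: contraNneq nuv => ->.
have nvt : v != t by apply: contraNneq nuv => ->.
have nuv' : u != v by apply: contraNneq nuv => ->.
have p0 : 0 < phi u by rewrite lt0n -s0 (inj_eq phiI).
have puv : phi u < phi v by rewrite ltn_neqAle uv (inj_eq phiI) nuv'.
have pvt : phi v < phi t by rewrite ltn_neqAle vt (inj_eq phiI) nvt.
have ne a b : connect E u a -> ~~ connect E u b -> phi a != phi b.
  by move=> ca nb; rewrite (inj_eq phiI); apply: contraNneq nb => <-.
(* No vertex reachable from [u] is an end of the chord and no edge crosses it, so all of them lie on
   the same side of it as [u]. *)
have separate x y : E x y -> ~~ connect E u x -> ~~ connect E u y ->
    forall z, connect E u z ->
    (minn (phi x) (phi y) < phi u < maxn (phi x) (phi y)) =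
    (minn (phi x) (phi y) < phi z < maxn (phi x) (phi y)).
  move=> Exy nx ny z /connectP[p].
  pose between w := minn (phi x) (phi y) < phi w < maxn (phi x) (phi y).
  suff along w : connect E u w -> path E w p -> z = last w p -> between w = between z.
    by move=> pth ez; apply: along.
  elim: p w => [|w' p IH] /= w cw; first by move=> _ ->.
  case/andP=> Eww' pth ez.
  have cw' : connect E u w' by apply: connect_trans cw (connect1 Eww').
  rewrite -(IH w' cw' pth ez) /between.
  have := ne w x cw nx; have := ne w y cw ny; have := ne w' x cw' nx; have := ne w' y cw' ny.
  by have := ncE _ _ _ _ Exy Eww'; rewrite /chords_cross /=; lia.
(* Such a chord does not separate [u] from [t], so a path from [s] to [v] can never enter the arc
   between them, although [v] lies on it. *)
pose inside x := phi u < phi x < phi t.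
have step x y : E x y -> ~~ connect E u x -> ~~ connect E u y -> inside x = inside y.
  move=> Exy nx ny; have := separate _ _ Exy nx ny t (ct u).
  have := ne u x (connect0 _ _) nx; have := ne u y (connect0 _ _) ny.
  have := ne t x (ct u) nx; have := ne t y (ct u) ny.
  by rewrite /inside; lia.
have [p pth ep] := connectP (cs v).
have : inside s = inside v.
  have pre w : connect E w v -> ~~ connect E u w.
    by move=> cw; apply: contra nuv => cu; exact: connect_trans cu cw.
  elim: p (s) pth ep => [|y p IH] /= x; first by move=> _ ->.
  case/andP=> Exy pth ep; rewrite -(IH y pth ep).
  have cy : connect E y v by apply/connectP; exists p.
  by apply: step => //; apply: pre => //; apply: connect_trans (connect1 Exy) cy.
by rewrite /inside s0 puv pvt ltn0.
Qed.

(** * Symmetries of the circle *)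

Definition between a b x := minn a b < x < maxn a b.

Lemma chords_crossE a b c d : chords_cross a b c d <->
  [&& c != a, c != b, d != a, d != b & between a b c != between a b d].
Proof. by rewrite /chords_cross /between /=; lia. Qed.

(* A rotation or a reflection of the circle at most exchanges the two arcs
   determined by a chord, for all points outside the chord simultaneously. *)
Lemma noncrossing_comp (V : finType) (E : rel V) (phi : V -> nat) (psi : nat -> nat)
    (flip : nat -> nat -> bool) :
  (forall u v x, phi x != phi u -> phi x != phi v ->
     between (psi (phi u)) (psi (phi v)) (psi (phi x))
     = flip (phi u) (phi v) (+) between (phi u) (phi v) (phi x)) ->
  noncrossing E phi -> noncrossing E (psi \o phi).
Proof.
move=> flipP ncE a b c d Eab Ecd /chords_crossE/and5P[/= ca cb da db bt].
have ne x y : psi (phi x) != psi (phi y) -> phi x != phi y by apply: contraNneq => ->.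
have := ncE _ _ _ _ Eab Ecd; rewrite chords_crossE !ne //=; apply.
by move: bt; rewrite !flipP ?ne //; case: (flip _ _); do 2!case: (between _ _ _).
Qed.

Definition rotate n k x := if k <= x then x - k else x + n - k.
Definition mirror n x := if x == 0 then 0 else n - x.

Lemma between_rotate n k a b x :
  k < n -> a < n -> b < n -> x < n -> x != a -> x != b ->
  between (rotate n k a) (rotate n k b) (rotate n k x)
  = ((k <= a) != (k <= b)) (+) between a b x.
Proof.
move=> kn an bn xn xa xb; rewrite /between /rotate.
by case: (leqP k a); case: (leqP k b); case: (leqP k x); lia.
Qed.

Lemma between_mirror n a b x :
  a < n -> b < n -> x < n -> x != a -> x != b ->
  between (mirror n a) (mirror n b) (mirror n x)
  = ((a == 0) != (b == 0)) (+) between a b x.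
Proof.
move=> an bn xn xa xb; rewrite /between /mirror.
by case: (a =P 0); case: (b =P 0); case: (x =P 0); lia.
Qed.

(** * The two chains and the cross edges between them *)

Section TwoChains.

Variables (n : nat) (V : finType) (E : rel V) (phi : V -> nat) (s t : V).
Hypotheses (phi_inj : injective phi) (phi_lt : forall v, phi v < n).
Hypotheses (ncE : noncrossing E phi) (phi_s : phi s = 0) (acE : dag E).
Hypotheses (cs : forall v, connect E s v) (ct : forall v, connect E v t).

Definition arc v := phi v <= phi t.
(** Distance from [s], at position [0], along the arc of [v]. *)
Definition depth v := if arc v then phi v else n - phi v.

Lemma depth_lt v : depth v < n.
Proof. by have := phi_lt v; rewrite /depth /arc; case: ifP; lia. Qed.

Lemma depth_inj u v : arc u = arc v -> depth u = depth v -> u = v.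
Proof.
rewrite /depth => -> e; apply: phi_inj; have := phi_lt u; have := phi_lt v.
by move: e; case: ifP; lia.
Qed.

(** On the arc containing [t] this is [arc_connect]; a reflection fixing [s] brings the other arc
    into the same situation. Acyclicity gives the converse. *)
Lemma depth_connect u v : arc u = arc v -> connect E u v = (depth u <= depth v).
Proof.
move=> es; have chain x y : arc x = arc y -> depth x <= depth y -> connect E x y.
  rewrite /depth => ->; case: ifP => [ay le|ay].
    by apply: (arc_connect phi_inj ncE phi_s cs ct); rewrite le.
  move=> le; have tgt0 : 0 < phi t.
    rewrite lt0n; apply/eqP => t0.
    have ts : t = s by apply: phi_inj; rewrite t0.
    have ys : y = s by apply: (dag_antisym acE) => //; rewrite -ts.
    by move: ay; rewrite /arc ys phi_s.
  have ncM : noncrossing E (mirror n \o phi).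
    apply: (noncrossing_comp (flip := fun a b => (a == 0) != (b == 0)) _ ncE) => a b z za zb.
    by apply: between_mirror; rewrite ?phi_lt.
  apply: (arc_connect _ ncM _ cs ct) => [a b /=||].
  - move=> e; apply: phi_inj; have := phi_lt a; have := phi_lt b; move: e.
    by rewrite /mirror; case: eqP; case: eqP; lia.
  - by rewrite /= phi_s.
  - move: ay le; have := phi_lt x; have := phi_lt y; rewrite /arc /= /mirror.
    by do 3![case: eqP]; lia.
apply/idP/idP => [c|]; last exact: chain.
rewrite leqNgt; apply/negP => lt.
have e := dag_antisym acE c (chain _ _ (esym es) (ltnW lt)).
by rewrite e ltnn in lt.
Qed.

Definition cross (p : V * V) := E p.1 p.2 && (arc p.1 != arc p.2).
Definition end_on (p : V * V) b := if arc p.1 == b then p.1 else p.2.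

Lemma cross_ends p : cross p ->
  [/\ minn (phi p.1) (phi p.2) = depth (end_on p true),
      maxn (phi p.1) (phi p.2) = n - depth (end_on p false) & maxn (phi p.1) (phi p.2) < n /\
      minn (phi p.1) (phi p.2) <= phi t < maxn (phi p.1) (phi p.2)].
Proof.
case: p => a b /andP[/= _]; have := phi_lt a; have := phi_lt b.
rewrite /end_on /depth /=; case aa: (arc a); case ab: (arc b) => //= ? ? _;
by rewrite ?aa ?ab; move: aa ab; rewrite /arc; split; lia.
Qed.

(** Depth grows with the position on one arc and decreases with it on the other, so a violation
    makes the endpoints interleave. *)
Lemma cross_noncrossing p q : cross p -> cross q ->
  depth (end_on p true) < depth (end_on q true) ->
  depth (end_on p false) <= depth (end_on q false).
Proof.
move=> cp cq lt; have [p1 p2 [p3 p4]] := cross_ends cp; have [q1 q2 [q3 q4]] := cross_ends cq.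
rewrite leqNgt; apply/negP => lt'.
case/andP: cp cq => Ep _ /andP[Eq _]; apply: (ncE Ep Eq); left.
by rewrite p1 p2 q1 q2 in p3 p4 q3 q4 *; lia.
Qed.

Lemma connect_cross u v : arc u != arc v -> connect E u v ->
  exists p, [/\ cross p, arc p.1 = arc u, connect E u p.1 & connect E p.2 v].
Proof.
move=> + /connectP[p]; elim: p u => [|x p IH] u /=; first by move=> ne _ e; rewrite e eqxx in ne.
move=> ne /andP[Eux pth] ev; case: (eqVneq (arc u) (arc x)) => [e|e].
  rewrite e in ne; have [q [cq aq cu cv]] := IH x ne pth ev.
  by exists q; rewrite e; split=> //; apply: connect_trans (connect1 Eux) cu.
exists (u, x); split=> //=; first by rewrite /cross /= Eux.
by apply/connectP; exists p.
Qed.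

(** As cross edges do not cross each other, sorting by the sum of depths sorts their ends along both
    arcs. *)
Definition cross_edges : seq (V * V) :=
  sort (relpre (fun p => depth p.1 + depth p.2) leq) (enum [pred p | cross p]).

Definition cross_edge m := nth (s, s) cross_edges m.
(* Beyond the last edge both functions continue with a sentinel that lies above
   all vertices. *)
Definition edge_type m := if m < size cross_edges then arc (cross_edge m).1 else true.
Definition edge_end m b := if m < size cross_edges then depth (end_on (cross_edge m) b) else n.

Lemma cross_edgeP m : m < size cross_edges -> cross (cross_edge m).
Proof.
by move=> lt; have := mem_nth (s, s) lt; rewrite mem_sort mem_enum.
Qed.

Lemma end_on_tail p b : arc p.1 = b -> end_on p b = p.1.
Proof. by rewrite /end_on => ->; rewrite eqxx. Qed.

Lemma end_on_head p b : arc p.1 != b -> end_on p b = p.2.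
Proof. by rewrite /end_on => /negbTE ->. Qed.

Lemma edge_end_mono b m m' : m <= m' -> edge_end m b <= edge_end m' b.
Proof.
rewrite /edge_end => le; case: ifP => [lt|]; case: ifP => [lt'|]; try by lia.
  have sum p : cross p -> depth p.1 + depth p.2 = depth (end_on p true) + depth (end_on p false).
    case/andP=> _; rewrite /end_on.
    by case: (arc p.1); case: (arc p.2) => //= _; rewrite addnC.
  have cm := cross_edgeP lt; have cm' := cross_edgeP lt'.
  have : depth (cross_edge m).1 + depth (cross_edge m).2
         <= depth (cross_edge m').1 + depth (cross_edge m').2.
    have srt : sorted (relpre (fun p => depth p.1 + depth p.2) leq) cross_edges.
      by apply: sort_sorted => x y; exact: leq_total.
    apply: (sorted_leq_nth _ _ (s, s) srt) => //.
    - by move=> x y z; exact: leq_trans.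
    - by move=> x /=.
  rewrite (sum _ cm) (sum _ cm').
  have := cross_noncrossing cm cm'; have := cross_noncrossing cm' cm.
  by case: b; lia.
by move=> _; apply: ltnW; exact: depth_lt.
Qed.

(** If the tail of edge [m] were not strictly before the head of the opposite edge [m'], the two
    edges would close a directed cycle. For a sentinel [m'], all depths are below [n]. *)
Lemma edge_end_strict m m' : m < m' -> edge_type m != edge_type m' ->
  edge_end m (edge_type m) < edge_end m' (edge_type m).
Proof.
move=> lt; have mono b := edge_end_mono b (ltnW lt).
rewrite /edge_type; case: ifP => lm; case: ifP => lm'; rewrite ?eqxx //; last by lia.
  move=> ne; set p := cross_edge m in ne *; set q := cross_edge m' in ne *.
  have cp : cross p := cross_edgeP lm; have cq : cross q := cross_edgeP lm'.
  have /andP[Ep sp] := cp; have /andP[Eq sq] := cq.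
  have a2 : arc p.2 = arc q.1 by move: ne sp; case: (arc p.1); case: (arc p.2); case: (arc q.1).
  have a1 : arc p.1 = arc q.2 by move: ne sq; case: (arc p.1); case: (arc q.2); case: (arc q.1).
  have := mono (arc p.1); have := mono (arc p.2).
  rewrite /edge_end lm lm' -/p -/q (end_on_head sp) (end_on_tail (esym a2)) (end_on_tail erefl).
  rewrite eq_sym in ne; rewrite (end_on_head ne) -(depth_connect a2) -(depth_connect a1) => c2 c1.
  rewrite ltnNge -(depth_connect (esym a1)); apply/negP => c3.
  have /negP[] := acE Ep; apply: connect_trans c2 _.
  by apply: connect_trans (connect1 Eq) c3.
by move=> _; rewrite /edge_end lm lm'; exact: depth_lt.
Qed.

Lemma prec_connect u v : arc u != arc v ->
  prec edge_type edge_end arc depth u v <-> connect E u v.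
Proof.
move=> ne; split.
  case=> m [tm um vm]; have lm : m < size cross_edges.
    by rewrite ltnNge; apply/negP => ge; move: vm; rewrite /edge_end ltnNge ge /=; have := depth_lt v; lia.
  move: tm um vm; rewrite /edge_type /edge_end lm => tm.
  have /andP[Ep sp] := cross_edgeP lm.
  have ne1 : arc (cross_edge m).1 != arc v by rewrite tm.
  have a2 : arc (cross_edge m).2 = arc v.
    by move: ne1 sp; case: (arc (cross_edge m).1); case: (arc (cross_edge m).2); case: (arc v).
  rewrite (end_on_tail tm) (end_on_head ne1) -(depth_connect (esym tm)) -(depth_connect a2) => c1 c2.
  by apply: connect_trans c1 (connect_trans (connect1 Ep) c2).
case/(connect_cross ne) => p [cp a1 c1 c2]; have /andP[Ep sp] := cp.
have pin : p \in cross_edges by rewrite mem_sort mem_enum.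
have lm : index p cross_edges < size cross_edges by rewrite index_mem.
have ep : cross_edge (index p cross_edges) = p by exact: nth_index.
have ne1 : arc p.1 != arc v by rewrite a1.
have a2 : arc p.2 = arc v.
  by move: ne1 sp; case: (arc p.1); case: (arc p.2); case: (arc v).
exists (index p cross_edges); rewrite /edge_type /edge_end lm ep; split=> //.
  by rewrite (end_on_tail a1) -(depth_connect (esym a1)).
by rewrite (end_on_head ne1) -(depth_connect a2).
Qed.

Lemma chains_drawing k : #|V| < 2 ^ k ->
  exists f g : V -> nat,
    (forall v, (f v, g v) \in intervals k 1 0 (1 + box_width k) /\ f v < g v) /\
    forall u v, u != v ->
      connect E u v = if arc u == arc v then (f u <= f v) && (g u <= g v) else g u <= f v.
Proof.
move=> szV.
have bound v b : depth v < edge_end (size cross_edges) b by rewrite /edge_end ltnn depth_lt.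
have [f [g [fgP ordP]]] := word_drawing edge_end_mono edge_end_strict depth_inj bound szV.
exists f, g; split=> // u v ne; have := ordP u v ne.
case: eqP => [es <-|/eqP ns]; last by rewrite (prec_connect ns) => H; apply/idP/idP => /H.
rewrite (depth_connect es) leq_eqVlt; case: eqP => // e.
by rewrite (depth_inj es e) eqxx in ne.
Qed.

End TwoChains.

Lemma st_outerplanar_intervals n (E : rel 'I_n) k : st_outerplanar E -> n < 2 ^ k ->
  exists (side : 'I_n -> bool) (f g : 'I_n -> nat),
    (forall v, (f v, g v) \in intervals k 1 0 (1 + box_width k) /\ f v < g v) /\
    forall u v, u != v -> connect E u v =
      if side u == side v then (f u <= f v) && (g u <= g v) else g u <= f v.
Proof.
case=> [[pos [pos_inj ncE]] [acE [[s sP] [t tP]]]] szn.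
have cs : forall v, connect E s v by apply: source_connect => // v /sP.
have ct : forall v, connect E v t by apply: sink_connect => // v /tP.
pose phi v := rotate n (pos s) (pos v).
have phi_lt v : phi v < n.
  by have := ltn_ord (pos v); have := ltn_ord (pos s); rewrite /phi /rotate; case: ifP; lia.
have phi_inj : injective phi.
  move=> u v; rewrite /phi /rotate => e; apply: pos_inj; apply: val_inj => /=.
  have := ltn_ord (pos v); have := ltn_ord (pos s); have := ltn_ord (pos u).
  by move: e; case: ifP; case: ifP; lia.
have ncphi : noncrossing E phi.
  have nc0 : noncrossing E (fun v => pos v : nat) by move=> a b c d; exact: ncE.
  apply: (noncrossing_comp (flip := fun a b => (pos s <= a) != (pos s <= b)) _ nc0) => u v x ? ?.
  exact: between_rotate.
have phi_s : phi s = 0 by rewrite /phi /rotate leqnn subnn.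
have szV : #|'I_n| < 2 ^ k by rewrite card_ord.
have := chains_drawing phi_inj phi_lt ncphi phi_s acE cs ct szV.
by exists (arc phi t).
Qed.

(** * The universal point set *)

Definition level n := (trunc_log 2 n).+1.

Definition grid n : seq (nat * nat) :=
  let ivs := intervals (level n) 1 0 (1 + box_width (level n)) in
  undup (ivs ++ [seq (p.2, p.1) | p <- ivs]).

Lemma ltn_level n : n < 2 ^ level n.
Proof. exact: trunc_log_ltn. Qed.

(** Both orders of [8 * k * 2 ^ k] intervals, with [k = level n] and [2 ^ k <= 2 * n]. *)
Lemma size_grid n : 0 < n -> size (grid n) <= 32 * (trunc_log 2 n).+1 * n.
Proof.
move=> n0; apply: leq_trans (size_undup _) _.
rewrite size_cat size_map size_intervals /level expnS.
by have := @trunc_logP 2 n isT n0; nia.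
Qed.

(* Real coordinates, padding and counting *)
From Stdlib Require Import Reals List Lra.

Lemma In_map_mem (T : eqType) (A : Type) (f : T -> A) (s : seq.seq T) (x : T) :
  x \in s -> In (f x) [seq f x | x <- s].
Proof.
elim: s => [|y s IH] //=; rewrite inE => /orP[/eqP ->|/IH]; by [left | right].
Qed.

Lemma In_map_inv (T : eqType) (A : Type) (f : T -> A) (s : seq.seq T) (y : A) :
  In y [seq f x | x <- s] -> exists2 x, x \in s & y = f x.
Proof.
elim: s => [|z s IH] //= [<-|/IH[x xs ->]]; first by exists z; rewrite ?mem_head.
by exists x; rewrite // inE xs orbT.
Qed.

Lemma NoDup_map_uniq (T : eqType) (A : Type) (f : T -> A) (s : seq.seq T) :
  injective f -> uniq s -> NoDup [seq f x | x <- s].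
Proof.
move=> f_inj; elim: s => [|y s IH] /=; first by move=> _; constructor.
case/andP=> nys us; constructor; last exact: IH.
by move=> yin; have [x xs /f_inj e] := In_map_inv yin; rewrite e xs in nys.
Qed.

Lemma length_size (A : Type) (s : seq.seq A) : length s = size s.
Proof. by elim: s => //= x s ->. Qed.

Lemma INR_leP (m n : nat) : Rle (INR m) (INR n) <-> (m <= n)%N.
Proof. by split=> [/INR_le /leP|/leP]; [|exact: le_INR]. Qed.

Definition nat_point (p : nat * nat) : (R * R)%type := (INR p.1, INR p.2).
(** Negative abscissae keep the padding apart from the grid. *)
Definition pad_point (i : nat) : (R * R)%type := (Ropp (INR i.+1), R0).

(** The grid exceeds [32 n log_2 n] by at most [32 n], so it fits within this size. *)
Definition target (n : nat) : nat :=
  (Z.to_nat (up (32 * INR n * log2 (INR n))%R) + 33 * n)%N.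

Definition universal_set (n : nat) : seq.seq (R * R) :=
  [seq nat_point p | p <- grid n] ++
  [seq pad_point i | i <- iota 0 (target n - size (grid n))].

Lemma nat_point_inj : injective nat_point.
Proof. by move=> [a b] [c d] [/INR_eq -> /INR_eq ->]. Qed.

Lemma pad_point_inj : injective pad_point.
Proof.
move=> i j e; apply/succn_inj/INR_eq.
by have : fst (pad_point i) = fst (pad_point j); [rewrite e | rewrite /pad_point /fst; lra].
Qed.

Lemma NoDup_universal_set n : NoDup (universal_set n).
Proof.
apply: NoDup_app.
- by apply: NoDup_map_uniq; [exact: nat_point_inj | exact: undup_uniq].
- by apply: NoDup_map_uniq; [exact: pad_point_inj | exact: iota_uniq].
- move=> x xn xp; have [[a b] _ xE] := In_map_inv xn; have [i _ xE'] := In_map_inv xp.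
  have : fst (nat_point (a, b)) = fst (pad_point i) by rewrite -xE xE'.
  rewrite /nat_point /pad_point /fst; have := pos_INR a.
  by have := lt_0_INR i.+1 (PeanoNat.Nat.lt_0_succ i); lra.
Qed.

Lemma INR_expn2 k : INR (expn 2 k) = (2 ^ k)%R.
Proof. by elim: k => [|k IH] //; rewrite expnS mult_INR IH. Qed.

Lemma trunc_log_le_log2 n : (0 < n)%N -> (INR (trunc_log 2 n) <= log2 (INR n))%R.
Proof.
move=> n0; have ln2 : (0 < ln 2)%R by have := ln_lt_2; lra.
apply: (Rmult_le_reg_r (ln 2)) => //.
rewrite /log2 /Rdiv Rmult_assoc Rinv_l ?Rmult_1_r; last by lra.
rewrite -ln_pow; last by lra.
have [lt|<-] : (2 ^ trunc_log 2 n < INR n \/ 2 ^ trunc_log 2 n = INR n)%R; last by lra.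
  apply: Rle_lt_or_eq; rewrite -INR_expn2; apply/INR_leP; exact: trunc_logP.
by apply/Rlt_le/ln_increasing => //; apply: pow_lt; lra.
Qed.

(** The excess is [33 n] plus a rounding error of at most [1], whence the bounds [n] and [34 n]. *)
Lemma size_universal_set n : (0 < n)%N ->
  (1 * INR n <= INR (length (universal_set n)) - 32 * INR n * log2 (INR n) <= 34 * INR n)%R.
Proof.
move=> n0; have n1 : (1 <= INR n)%R by apply/(INR_leP 1).
set x := (32 * INR n * log2 (INR n))%R.
have tl := trunc_log_le_log2 n0.
have x0 : (0 <= x)%R.
  by rewrite /x; have := pos_INR (trunc_log 2 n); nra.
have [up1 up2] := archimed x.
have up0 : (0 <= up x)%Z by apply: le_IZR; lra.
have tE : INR (target n) = (IZR (up x) + 33 * INR n)%R.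
  rewrite /target -/x plus_INR mult_INR INR_IZR_INZ Znat.Z2Nat.id //; congr (_ + _ * _)%R.
  by rewrite INR_IZR_INZ.
have szle : (size (grid n) <= target n)%N.
  apply/INR_leP; rewrite tE.
  apply: (Rle_trans _ (INR (32 * (trunc_log 2 n).+1 * n)%N)); first exact/INR_leP/size_grid.
  rewrite !mult_INR (S_INR (trunc_log _ _)) (_ : INR 32 = 32%R); last by rewrite INR_IZR_INZ.
  move: up1; rewrite /x; nra.
have -> : length (universal_set n) = target n.
  by rewrite length_size size_cat !size_map size_iota subnKC.
rewrite tE; lra.
Qed.

Theorem theorem12 :
  exists U : nat -> list (R * R)%type,
    (forall n : nat, NoDup (U n)) /\
    (exists (c1 c2 : R) (N : nat), (0 < c1)%R /\ (0 < c2)%R /\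
       forall n : nat, (N <= n)%N ->
         (c1 * INR n <= INR (length (U n)) - 32 * INR n * log2 (INR n) <= c2 * INR n)%R) /\
    (forall (n : nat) (E : rel 'I_n), st_outerplanar E ->
       exists p : 'I_n -> (R * R)%type,
         dominance_drawing E p /\ forall v : 'I_n, In (p v) (U n)).
Proof.
exists universal_set; split; first exact: NoDup_universal_set.
split; first by exists 1%R, 34%R, 1%N; split; [lra | split; [lra | exact: size_universal_set]].
move=> n E stE; have [_ [acE _]] := stE.
have [side [f [g [fgP ordP]]]] := st_outerplanar_intervals stE (ltn_level n).
pose p v := nat_point (if side v then (f v, g v) else (g v, f v)).
have drawn u v : connect E u v <-> (Rle (fst (p u)) (fst (p v)) /\ Rle (snd (p u)) (snd (p v))).
  case: (eqVneq u v) => [->|ne].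
    by split=> // _; split; exact: Rle_refl.
  rewrite /p /nat_point /= !INR_leP (ordP u v ne).
  have [_ fgu] := fgP u; have [_ fgv] := fgP v.
  (* On different sides, of the two coordinate inequalities only [g u <= f v] matters: it implies
     [f u <= g v], since [f < g] at both vertices. *)
  by case: (side u); case: (side v) => /=; lia.
exists p; split; last first.
  move=> v; apply/in_app_iff; left; apply: In_map_mem; have [mem _] := fgP v.
  rewrite mem_undup mem_cat; case: (side v); first by rewrite mem.
  by apply/orP; right; apply/mapP; exists (f v, g v).
split=> // u v e; apply: (dag_antisym acE); apply/drawn; rewrite e; split; exact: Rle_refl.
Qed.
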